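(* The Cauchy product (convolution) in $\ell_1(\mathbb{N}_0)$, regarded as the bilinear map $\ell_1(\mathbb{N}_0)\times\ell_1(\mathbb{N}_0)\to\ell_1(\mathbb{N}_0)$, $(x,y)\mapsto x\ast y$, is not an open map.
   Context: $\mathbb{N}_0=\{0,1,2,\ldots\}$ is the additive semigroup of non-negative integers. $\ell_1(\mathbb{N}_0)$ is the Banach space of absolutely summable scalar sequences $x=(\xi_n)_{n\ge 0}$ with norm $\|x\|=\sum_n|\xi_n|$ (the statement is asserted both for real and for complex scalars). For $x=(\xi_n)$, $y=(\eta_n)$ the Cauchy product is $x\ast y=\big(\sum_{k=0}^n\xi_k\eta_{n-k}\big)_{n\ge0}$. A map is open if it sends open sets to open sets. *)

(* Defs.v *)
From Stdlib Require Import Reals Lra Lia ProofIrrelevance FunctionalExtensionality.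
From Coquelicot Require Import Coquelicot.

Local Open Scope R_scope.

(* l1 K is ell_1(N_0) with scalars K, where K will be R_AbsRing
   (absolute value Rabs) or C_AbsRing (absolute value Cmod). *)
Record l1 (K : AbsRing) : Type := mk_l1 {
  l1_seq :> nat -> K;
  l1_summable : ex_series (fun n => abs (l1_seq n))
}.

Arguments mk_l1 {K} _ _.
Arguments l1_seq {K} _ _.
Arguments l1_summable {K} _.

Lemma l1_ext (K : AbsRing) (x y : l1 K) : (forall n, x n = y n) -> x = y.
Proof.
  destruct x as [x Hx], y as [y Hy]; simpl; intros H.
  assert (E : x = y) by (apply functional_extensionality; exact H).
  subst y; f_equal; apply proof_irrelevance.
Qed.

Lemma ex_series_dominated (K : AbsRing) (x : nat -> K) (b : nat -> R) :
  (forall n, abs (x n) <= b n) -> ex_series b -> ex_series (fun n => abs (x n)).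
Proof.
  intros H Hb.
  apply (@ex_series_le R_AbsRing R_CompleteNormedModule _ b); [|exact Hb].
  intros n; change (Rabs (abs (x n)) <= b n).
  rewrite Rabs_pos_eq; [apply H | apply abs_ge_0].
Qed.

Lemma l1_zero_summable (K : AbsRing) :
  ex_series (fun _ : nat => abs (zero : K)).
Proof.
  exists 0; apply is_series_Reals; intros e He; exists 0%nat; intros n _.
  rewrite abs_zero, sum_cte, Rmult_0_l.
  unfold Rdist; rewrite Rminus_0_r, Rabs_R0; exact He.
Qed.

Lemma l1_plus_summable (K : AbsRing) (x y : l1 K) :
  ex_series (fun n => abs (plus (x n) (y n))).
Proof.
  apply ex_series_dominated with (fun n => abs (x n) + abs (y n)).
  - intros n; apply abs_triangle.
  - exact (ex_series_plus _ _ (l1_summable x) (l1_summable y)).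
Qed.

Lemma l1_opp_summable (K : AbsRing) (x : l1 K) :
  ex_series (fun n => abs (opp (x n))).
Proof.
  apply ex_series_dominated with (fun n => abs (x n)).
  - intros n; rewrite abs_opp; apply Rle_refl.
  - exact (l1_summable x).
Qed.

Lemma l1_scal_summable (K : AbsRing) (a : K) (x : l1 K) :
  ex_series (fun n => abs (mult a (x n))).
Proof.
  apply ex_series_dominated with (fun n => abs a * abs (x n)).
  - intros n; apply abs_mult.
  - exact (ex_series_scal_l (abs a) _ (l1_summable x)).
Qed.

Definition l1_zero (K : AbsRing) : l1 K := mk_l1 _ (l1_zero_summable K).
Definition l1_plus (K : AbsRing) (x y : l1 K) : l1 K :=
  mk_l1 _ (l1_plus_summable K x y).
Definition l1_opp (K : AbsRing) (x : l1 K) : l1 K :=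
  mk_l1 _ (l1_opp_summable K x).
Definition l1_scal (K : AbsRing) (a : K) (x : l1 K) : l1 K :=
  mk_l1 _ (l1_scal_summable K a x).

Definition l1_norm (K : AbsRing) (x : l1 K) : R := Series (fun n => abs (x n)).

Lemma l1_plus_comm (K : AbsRing) (x y : l1 K) :
  l1_plus K x y = l1_plus K y x.
Proof. apply l1_ext; intros n; apply plus_comm. Qed.

Lemma l1_plus_assoc (K : AbsRing) (x y z : l1 K) :
  l1_plus K x (l1_plus K y z) = l1_plus K (l1_plus K x y) z.
Proof. apply l1_ext; intros n; apply plus_assoc. Qed.

Lemma l1_plus_zero_r (K : AbsRing) (x : l1 K) : l1_plus K x (l1_zero K) = x.
Proof. apply l1_ext; intros n; apply plus_zero_r. Qed.

Lemma l1_plus_opp_r (K : AbsRing) (x : l1 K) :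
  l1_plus K x (l1_opp K x) = l1_zero K.
Proof. apply l1_ext; intros n; apply (plus_opp_r (x n)). Qed.

Definition l1_AbelianMonoid_mixin (K : AbsRing) :=
  AbelianMonoid.Mixin (l1 K) _ _ (l1_plus_comm K) (l1_plus_assoc K)
    (l1_plus_zero_r K).

Canonical l1_AbelianMonoid (K : AbsRing) :=
  AbelianMonoid.Pack (l1 K) (l1_AbelianMonoid_mixin K) (l1 K).

Definition l1_AbelianGroup_mixin (K : AbsRing) :=
  AbelianGroup.Mixin (l1_AbelianMonoid K) _ (l1_plus_opp_r K).

Canonical l1_AbelianGroup (K : AbsRing) :=
  AbelianGroup.Pack (l1 K)
    (AbelianGroup.Class _ (l1_AbelianMonoid_mixin K) (l1_AbelianGroup_mixin K))
    (l1 K).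

Lemma l1_scal_assoc (K : AbsRing) (a b : K) (x : l1 K) :
  l1_scal K a (l1_scal K b x) = l1_scal K (mult a b) x.
Proof. apply l1_ext; intros n; apply (mult_assoc a b (x n)). Qed.

Lemma l1_scal_one (K : AbsRing) (x : l1 K) : l1_scal K one x = x.
Proof. apply l1_ext; intros n; apply (mult_one_l (x n)). Qed.

Lemma l1_scal_distr_l (K : AbsRing) (a : K) (x y : l1 K) :
  l1_scal K a (plus x y) = plus (l1_scal K a x) (l1_scal K a y).
Proof. apply l1_ext; intros n; apply (mult_distr_l a (x n) (y n)). Qed.

Lemma l1_scal_distr_r (K : AbsRing) (a b : K) (x : l1 K) :
  l1_scal K (plus a b) x = plus (l1_scal K a x) (l1_scal K b x).
Proof. apply l1_ext; intros n; apply (mult_distr_r a b (x n)). Qed.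

Definition l1_ModuleSpace_mixin (K : AbsRing) :=
  ModuleSpace.Mixin K (l1_AbelianGroup K) _ (l1_scal_assoc K) (l1_scal_one K)
    (l1_scal_distr_l K) (l1_scal_distr_r K).

Canonical l1_ModuleSpace (K : AbsRing) :=
  ModuleSpace.Pack K (l1 K)
    (ModuleSpace.Class _ _ _ (l1_ModuleSpace_mixin K)) (l1 K).

Lemma l1_norm_triangle (K : AbsRing) (x y : l1 K) :
  l1_norm K (plus x y) <= l1_norm K x + l1_norm K y.
Proof.
  unfold l1_norm.
  rewrite <- (Series_plus _ _ (l1_summable x) (l1_summable y)).
  apply Series_le.
  - intros n; split; [apply abs_ge_0 | apply abs_triangle].
  - exact (ex_series_plus _ _ (l1_summable x) (l1_summable y)).
Qed.

Lemma l1_norm_scal (K : AbsRing) (a : K) (x : l1 K) :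
  l1_norm K (scal a x) <= abs a * l1_norm K x.
Proof.
  unfold l1_norm; rewrite <- Series_scal_l.
  apply Series_le.
  - intros n; split; [apply abs_ge_0 | apply abs_mult].
  - exact (ex_series_scal_l (abs a) _ (l1_summable x)).
Qed.

Lemma l1_norm_zero (K : AbsRing) : l1_norm K zero = 0.
Proof.
  unfold l1_norm; rewrite (Series_ext _ (fun n => 0 * 0)).
  - rewrite Series_scal_l; apply Rmult_0_l.
  - intros n; rewrite Rmult_0_l; apply abs_zero.
Qed.

Lemma l1_norm_opp (K : AbsRing) (x : l1 K) : l1_norm K (opp x) = l1_norm K x.
Proof. unfold l1_norm; apply Series_ext; intros n; apply abs_opp. Qed.

Lemma l1_abs_le_norm (K : AbsRing) (x : l1 K) (n : nat) :
  abs (x n) <= l1_norm K x.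
Proof.
  unfold l1_norm.
  rewrite (Series_incr_n _ (S n) (Nat.lt_0_succ n) (l1_summable x)); simpl pred.
  assert (Htail : 0 <= Series (fun k => abs (x (S n + k)%nat))).
  { replace 0 with (Series (fun _ => 0 * 0)).
    - apply Series_le.
      + intros k; rewrite Rmult_0_l; split; [apply Rle_refl | apply abs_ge_0].
      + exact (proj1 (ex_series_incr_n (fun k => abs (x k)) (S n)) (l1_summable x)).
    - rewrite Series_scal_l; apply Rmult_0_l. }
  assert (Hhead : abs (x n) <= sum_f_R0 (fun k => abs (x k)) n).
  { destruct n as [|n]; simpl; [apply Rle_refl|].
    assert (0 <= sum_f_R0 (fun k => abs (x k)) n)
      by (apply cond_pos_sum; intros k; apply abs_ge_0).
    lra. }
  lra.
Qed.

Lemma l1_norm_eq_zero (K : AbsRing) (x : l1 K) : l1_norm K x = 0 -> x = zero.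
Proof.
  intros H; apply l1_ext; intros n; apply abs_eq_zero.
  apply Rle_antisym; [rewrite <- H; apply l1_abs_le_norm | apply abs_ge_0].
Qed.

Definition l1_ball (K : AbsRing) (x : l1 K) (e : R) (y : l1 K) : Prop :=
  l1_norm K (minus y x) < e.

Lemma l1_ball_center (K : AbsRing) (x : l1 K) (e : posreal) : l1_ball K x e x.
Proof.
  unfold l1_ball; rewrite minus_eq_zero, l1_norm_zero; apply cond_pos.
Qed.

Lemma l1_ball_sym (K : AbsRing) (x y : l1 K) (e : R) :
  l1_ball K x e y -> l1_ball K y e x.
Proof. unfold l1_ball; rewrite <- opp_minus, l1_norm_opp; trivial. Qed.

Lemma l1_ball_triangle (K : AbsRing) (x y z : l1 K) (e1 e2 : R) :
  l1_ball K x e1 y -> l1_ball K y e2 z -> l1_ball K x (e1 + e2) z.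
Proof.
  unfold l1_ball; intros H1 H2.
  rewrite (minus_trans y z x).
  eapply Rle_lt_trans; [apply l1_norm_triangle | lra].
Qed.

Definition l1_UniformSpace_mixin (K : AbsRing) :=
  UniformSpace.Mixin (l1 K) (l1_zero K) _ (l1_ball_center K) (l1_ball_sym K)
    (l1_ball_triangle K).

Canonical l1_UniformSpace (K : AbsRing) :=
  UniformSpace.Pack (l1 K) (l1_UniformSpace_mixin K) (l1 K).

Canonical l1_NormedModuleAux (K : AbsRing) :=
  NormedModuleAux.Pack K (l1 K)
    (NormedModuleAux.Class K _
       (ModuleSpace.class K (l1_ModuleSpace K)) (l1_UniformSpace_mixin K))
    (l1 K).

Lemma l1_norm_ball1 (K : AbsRing) (x y : l1_NormedModuleAux K) (e : R) :
  l1_norm K (minus y x) < e -> ball x e y.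
Proof. exact (fun H => H). Qed.

Lemma l1_norm_ball2 (K : AbsRing) (x y : l1_NormedModuleAux K) (e : posreal) :
  ball x e y -> l1_norm K (minus y x) < 1 * e.
Proof. intros H; rewrite Rmult_1_l; exact H. Qed.

Definition l1_NormedModule_mixin (K : AbsRing) :=
  NormedModule.Mixin K (l1_NormedModuleAux K) (l1_norm K) 1
    (l1_norm_triangle K) (l1_norm_scal K) (l1_norm_ball1 K) (l1_norm_ball2 K)
    (l1_norm_eq_zero K).

Canonical l1_NormedModule (K : AbsRing) :=
  NormedModule.Pack K (l1 K)
    (NormedModule.Class _ _ _ (l1_NormedModule_mixin K)) (l1 K).

(* sum_n u n is the sum u 0 + ... + u n (n+1 terms). *)
Definition cauchy_seq {K : AbsRing} (x y : nat -> K) (n : nat) : K :=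
  sum_n (fun k => mult (x k) (y (n - k)%nat)) n.

Lemma cauchy_seq_summable (K : AbsRing) (x y : l1 K) :
  ex_series (fun n => abs (cauchy_seq x y n)).
Proof.
  apply ex_series_dominated
    with (fun n => sum_f_R0 (fun k => abs (x k) * abs (y (n - k)%nat)) n).
  - intros n; unfold cauchy_seq.
    rewrite <- sum_n_Reals.
    eapply Rle_trans;
      [apply (norm_sum_n_m (V := AbsRing_NormedModule K)) |].
    apply sum_n_m_le; intros k; apply abs_mult.
  - assert (Habs : forall z : l1 K, ex_series (fun n => Rabs (abs (z n)))).
    { intros z; apply ex_series_ext with (2 := l1_summable z).
      intros n; symmetry; apply Rabs_pos_eq, abs_ge_0. }
    eexists.
    exact (is_series_mult _ _ _ _
             (Series_correct _ (l1_summable x))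
             (Series_correct _ (l1_summable y)) (Habs x) (Habs y)).
Qed.

Definition cauchy_product {K : AbsRing} (x y : l1 K) : l1 K :=
  mk_l1 (cauchy_seq x y) (cauchy_seq_summable K x y).

Definition is_open_map {U V : UniformSpace} (f : U -> V) : Prop :=
  forall D : U -> Prop, open D -> open (fun v => exists u, D u /\ f u = v).

(* Main.v *)
(** The product is not open at [(z, 0)], where [z] is the unit mass at [1].
    Convolution with [z] is an isometry onto the sequences vanishing at [0].
    Suppose [x] is within distance [d < 1] of [z] and [x * y = c e_0]. Comparing
    the coefficients of positive index gives
    [||y|| <= ||(x - z) * y|| <= d ||y||], so [y = 0] and [c = 0]. Hence the
    image of a neighbourhood of [(z, 0)] contains [0] but none of the constants
    [c e_0] with [c <> 0]. *)
Require Import Defs.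
From Stdlib Require Import Reals Lra Lia.
From Coquelicot Require Import Coquelicot.

Local Open Scope R_scope.

Definition single_seq {K : AbsRing} (m : nat) (c : K) (n : nat) : K :=
  if Nat.eqb n m then c else zero.

(** Induction on [m]: removing the first term moves the unit mass down one index; at [m = 0] the
    remaining tail is zero. *)
Lemma is_series_abs_single (K : AbsRing) (m : nat) (c : K) :
  is_series (fun n => abs (single_seq m c n)) (abs c : R).
Proof.
  induction m as [|m IH]; apply is_series_decr_1.
  - unfold single_seq; simpl.
    replace (plus _ _) with (@zero R_AbelianGroup)
      by (symmetry; apply (plus_opp_r (G := R_AbelianGroup))).
    apply is_series_ext with (fun _ => @zero R_AbelianGroup).
    + intros n; symmetry; apply abs_zero.
    + apply filterlim_ext with (fun _ => @zero R_AbelianGroup).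
      * intros n; symmetry; apply (sum_n_m_const_zero (G := R_AbelianGroup)).
      * apply filterlim_const.
  - unfold single_seq at 2; simpl; rewrite abs_zero.
    replace (plus _ _) with (abs c : R) by (change (abs c = abs c + - 0); ring).
    exact IH.
Qed.

Definition l1_single {K : AbsRing} (m : nat) (c : K) : l1 K :=
  mk_l1 (single_seq m c) (ex_intro _ _ (is_series_abs_single K m c)).

Lemma l1_norm_single (K : AbsRing) (m : nat) (c : K) :
  l1_norm K (l1_single m c) = abs c.
Proof. exact (is_series_unique _ _ (is_series_abs_single K m c)). Qed.

(** By the triangle inequality each coefficient is bounded by that of the Cauchy product of the
    series of absolute values, which sums to the product of the norms. *)
Lemma l1_norm_cauchy_product (K : AbsRing) (x y : l1 K) :
  l1_norm K (cauchy_product x y) <= l1_norm K x * l1_norm K y.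
Proof.
  assert (Habs : forall z : l1 K, ex_series (fun n => Rabs (abs (z n)))).
  { intros z; apply ex_series_ext with (2 := l1_summable z).
    intros n; symmetry; apply Rabs_pos_eq, abs_ge_0. }
  pose proof (is_series_mult _ _ _ _
                (Series_correct _ (l1_summable x))
                (Series_correct _ (l1_summable y)) (Habs x) (Habs y)) as H.
  unfold l1_norm at 2 3; rewrite <- (is_series_unique _ _ H).
  apply Series_le; [|eexists; exact H].
  intros n; split; [apply abs_ge_0|].
  simpl; unfold cauchy_seq; rewrite <- sum_n_Reals.
  eapply Rle_trans; [apply (norm_sum_n_m (V := AbsRing_NormedModule K))|].
  apply sum_n_m_le; intros k; apply abs_mult.
Qed.

Lemma cauchy_seq_plus_l (K : AbsRing) (x x' y : nat -> K) (n : nat) :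
  cauchy_seq (fun k => plus (x k) (x' k)) y n
  = plus (cauchy_seq x y n) (cauchy_seq x' y n).
Proof.
  unfold cauchy_seq; rewrite <- sum_n_plus.
  apply sum_n_ext; intros k; apply (mult_distr_r (x k)).
Qed.

Lemma cauchy_seq_shift (K : AbsRing) (y : nat -> K) (n : nat) :
  cauchy_seq (single_seq 1 one) y (S n) = y n.
Proof.
  unfold cauchy_seq, sum_n.
  (* Split off the terms [k = 0] and [k = 1]; only the second is nonzero, and the rest of the sum
     vanishes. *)
  rewrite sum_Sn_m, sum_Sn_m by lia.
  rewrite (sum_n_m_ext_loc _ (fun _ => zero)).
  - rewrite sum_n_m_const_zero; unfold single_seq; simpl.
    rewrite Nat.sub_0_r, plus_zero_r.
    rewrite (mult_zero_l (K := K)), plus_zero_l.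
    apply (mult_one_l (K := K)).
  - intros k [Hk _]; unfold single_seq.
    rewrite (proj2 (Nat.eqb_neq k 1)) by lia.
    apply (mult_zero_l (K := K)).
Qed.

Lemma cauchy_product_near_shift_single (K : AbsRing) (x y : l1 K) (c : K) :
  l1_norm K (minus x (l1_single 1 one)) < 1 ->
  cauchy_product x y = l1_single 0 c -> c = zero.
Proof.
  intros Hx Hxy.
  set (u := minus x (l1_single 1 one) : l1 K) in *.
  assert (Hseq : forall n, cauchy_seq x y n = single_seq 0 c n)
    by (intros n; exact (f_equal (fun z : l1 K => z n) Hxy)).
  assert (Hxu : forall n, x n = plus (single_seq 1 one n) (u n)).
  { intros n; change (u n) with (minus (x n) (single_seq 1 one n)).
    unfold minus; rewrite plus_comm, <- plus_assoc, (plus_opp_l (G := K)).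
    symmetry; apply plus_zero_r. }
  clearbody u.
  (* With [x] equal to the unit mass at 1 plus [u], the vanishing coefficient of index [S n] of the
     product is [y n] plus that of [u * y]. *)
  assert (Hy : forall n, y n = opp (cauchy_product u y (S n))).
  { intros n; apply (plus_reg_r (G := K) (cauchy_product u y (S n))).
    rewrite (plus_opp_l (G := K)), <- (cauchy_seq_shift K y n).
    transitivity (cauchy_seq x y (S n)); [symmetry | apply Hseq].
    etransitivity; [|apply cauchy_seq_plus_l].
    apply sum_n_ext; intros k; rewrite Hxu; reflexivity. }
  (* The coefficients of [u * y] of positive index already have total mass [||y||]. *)
  assert (Hle : l1_norm K y <= l1_norm K (cauchy_product u y)).
  { unfold l1_norm at 2; rewrite Series_incr_1 by apply l1_summable.
    unfold l1_norm; rewrite (Series_ext (fun n => abs (y n))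
      (fun n => abs (cauchy_product u y (S n)))).
    - pose proof (abs_ge_0 (cauchy_product u y 0%nat)); lra.
    - intros n; rewrite Hy; apply abs_opp. }
  pose proof (l1_norm_cauchy_product K u y) as Hmul.
  assert (Hy0 : abs (y 0%nat) = 0).
  (* Since [||y|| <= ||u|| ||y||] and [||u|| < 1], the norm of [y] is at most 0. *)
  { pose proof (l1_abs_le_norm K y 0); pose proof (abs_ge_0 (y 0%nat)); nra. }
  apply abs_eq_zero in Hy0.
  (* The coefficient of index 0 gives [c = x 0 * y 0]. *)
  change c with (single_seq 0 c 0%nat); rewrite <- Hseq.
  unfold cauchy_seq; rewrite sum_O; simpl; rewrite Hy0.
  apply (mult_zero_r (K := K)).
Qed.

Lemma cauchy_product_zero_r (K : AbsRing) (x : l1 K) :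
  cauchy_product x zero = zero.
Proof.
  apply l1_ext; intros n.
  transitivity (sum_n (fun _ => @zero K) n).
  - apply sum_n_ext; intros k; apply (mult_zero_r (K := K)).
  - apply sum_n_m_const_zero.
Qed.

(** Small nonzero scalars put some nonzero [c e_0] in every ball about 0; a discrete absolute value
    would not provide them. *)
Lemma cauchy_product_not_open (K : AbsRing) :
  (forall e : posreal, exists c : K, c <> zero /\ abs c < e) ->
  ~ is_open_map (fun p : l1 K * l1 K => cauchy_product (fst p) (snd p)).
Proof.
  intros Hsmall Hopen.
  pose (z := l1_single 1 one : l1 K).
  (* Only the first factor is constrained: the open set is a cylinder over the unit ball about
     [z]. *)
  assert (HD : open (fun p : l1 K * l1 K => l1_norm K (minus (fst p) z) < 1)).
  { intros [p1 p2] Hp; simpl in Hp.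
    assert (He : 0 < 1 - l1_norm K (minus p1 z)) by lra.
    exists (mkposreal _ He); intros [q1 q2] [Hq _]; simpl.
    change (l1_norm K (minus q1 p1) < 1 - l1_norm K (minus p1 z)) in Hq.
    rewrite (minus_trans p1).
    eapply Rle_lt_trans; [apply l1_norm_triangle | lra]. }
  destruct (Hopen _ HD zero) as [e He].
  - exists (z, zero); simpl; split.
    + rewrite minus_eq_zero, l1_norm_zero; lra.
    + apply cauchy_product_zero_r.
  - destruct (Hsmall e) as [c [Hc0 Hc]].
    destruct (He (l1_single 0 c)) as [[x y] [Hx Hxy]].
    + change (l1_norm K (minus (l1_single 0 c) zero) < e).
      rewrite minus_zero_r, l1_norm_single; exact Hc.
    + exact (Hc0 (cauchy_product_near_shift_single K x y c Hx Hxy)).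
Qed.

Theorem corollary4p8 :
  ~ is_open_map
      (fun p : l1 R_AbsRing * l1 R_AbsRing => cauchy_product (fst p) (snd p))
  /\
  ~ is_open_map
      (fun p : l1 C_AbsRing * l1 C_AbsRing => cauchy_product (fst p) (snd p)).
Proof.
  split; apply cauchy_product_not_open; intros e; pose proof (cond_pos e) as He.
  - exists (e / 2); split.
    + change (e / 2 <> 0); lra.
    + change (Rabs (e / 2) < e); rewrite Rabs_pos_eq; lra.
  - exists (RtoC (e / 2)); split.
    + intros H; apply RtoC_inj in H; lra.
    + change (Cmod (RtoC (e / 2)) < e); rewrite Cmod_R, Rabs_pos_eq; lra.
Qed.
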